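(* Let $\mathbf{c}=(c_1,\ldots,c_n)$ be a sequence of $n\ge 3$ positive integers, and let $C[\mathbf{c}]$ be any network whose underlying simple graph is a cycle and whose spindles have sizes $c_1,\ldots,c_n$. Let $m=c_1+\cdots+c_n$. Then $$J^{C[\mathbf{c}]}_{\delta(n+m)}=(n-2)\,x^{\nu[\mathbf{c}]}S_{c_1}\cdots S_{c_n}$$ and $J^{C[\mathbf{c}]}_1\prec J^{C[\mathbf{c}]}_0$.
   Context: A network is a finite connected multigraph without loops, possibly with multiple edges. For a network $G$ with $m$ edges and $n$ vertices, put $d=m-n+1$. Let $R_G(q)$ be the probability that the spanning subgraph obtained by deleting each edge independently with probability $q$ is connected; this is a polynomial. Define $H_G(q)=(1-q)^{1-n}R_G(q)$, which is a polynomial of degree $d$. Define $J_G(u)=(u-1)^dH_G\big(\frac{-1-u}{1-u}\right)$, a polynomial. Write $J_G(u)=J^G_0(u^2)+uJ^G_1(u^2)$ with $J^G_0,J^G_1\in\mathbb{R}[x]$. The underlying simple graph of $G$ has the same vertices as $G$ and one edge for each adjacent pair. A $c$-spindle is a maximal set of $c\ge1$ edges of $G$ all joining the same pair of vertices. For natural numbers $c$, define $E_c,O_c\in\mathbb{R}[x]$ by $(u+1)^c=E_c(u^2)+uO_c(u^2)$. Let $\varepsilon(c)=1$ if $c$ is even and $0$ if $c$ is odd, and let $\delta(c)=1-\varepsilon(c)$. Let $S_c=O_c$ if $c$ is even and $S_c=E_c$ if $c$ is odd. Finally, $\nu[\mathbf{c}]=\lfloor(\varepsilon(c_1)+\cdots+\varepsilon(c_n))/2\rfloor$.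 Relation $\prec$: for $A,B\in\mathbb{R}[x]$ with only real zeros, with zeros $\xi_1\le\cdots\le\xi_a$ of $A$ and $\theta_1\le\cdots\le\theta_b$ of $B$, $A\prec B$ means one of the following: - $\deg B=\deg A+1$ and $\theta_1\le\xi_1\le\theta_2\le\cdots\le\xi_a\le\theta_{a+1}$; - $\deg A=\deg B$ and $\xi_1\le\theta_1\le\xi_2\le\cdots\le\xi_a\le\theta_a$. By convention $A\prec0$ and $0\prec A$ for every $A$ with only real zeros. *)

(* Defs.v *)
From HB Require Import structures.
From mathcomp Require Import all_boot all_order all_algebra all_fingroup.
From mathcomp Require Import reals.
Set Implicit Arguments. Unset Strict Implicit. Unset Printing Implicit Defensive.
Import Order.TTheory GRing.Theory Num.Theory.
Local Open Scope ring_scope.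

(* A network (multigraph) is given by a finite vertex type V, a finite edge
   type E, and an endpoint map ends : E -> V * V (edge e joins (ends e).1 and
   (ends e).2; the orientation is irrelevant). *)

Definition joins (V E : finType) (ends : E -> V * V) (e : E) (x y : V) : bool :=
  (ends e == (x, y)) || (ends e == (y, x)).

Definition sub_adj (V E : finType) (ends : E -> V * V) (S : {set E}) : rel V :=
  fun x y => [exists e in S, joins ends e x y].

Definition spanning_connected (V E : finType) (ends : E -> V * V) (S : {set E}) : bool :=
  [forall x : V, forall y : V, connect (sub_adj ends S) x y].

Section Polys.
Variable R : realType.
Variables (V E : finType) (ends : E -> V * V).

(* Reliability polynomial R_G(q): probability that the spanning subgraph
   obtained by deleting each edge independently with probability q is
   connected, i.e. sum over connected spanning edge sets S of
   (1-q)^|S| q^(m-|S|). *)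
Definition relpoly : {poly R} :=
  \sum_(S : {set E} | spanning_connected ends S)
     (1 - 'X) ^+ #|S| * 'X ^+ (#|E| - #|S|).

Definition cyclo_rank : nat := (#|E| + 1 - #|V|)%N.

Definition Hpoly : {poly R} := relpoly %/ (1 - 'X) ^+ (#|V|.-1).

(* J_G(u) = (u-1)^d H_G((-1-u)/(1-u)); writing H_G(q) = sum_k h_k q^k
   (deg H_G = d), this is sum_(k<=d) h_k (u-1)^(d-k) (u+1)^k. *)
Definition Jpoly : {poly R} :=
  \sum_(k < cyclo_rank.+1)
     Hpoly`_k *: (('X - 1) ^+ (cyclo_rank - k) * ('X + 1) ^+ k).

Definition J0 : {poly R} := even_poly Jpoly.
Definition J1 : {poly R} := odd_poly Jpoly.
End Polys.

Definition Epoly (R : realType) (c : nat) : {poly R} := even_poly (('X + 1) ^+ c).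
Definition Opoly (R : realType) (c : nat) : {poly R} := odd_poly (('X + 1) ^+ c).

Definition eps (c : nat) : nat := ~~ odd c.
Definition delta (c : nat) : nat := odd c.

Definition Spoly (R : realType) (c : nat) : {poly R} :=
  if ~~ odd c then Opoly R c else Epoly R c.

Definition nu (n : nat) (c : 'I_n -> nat) : nat := ((\sum_(i < n) eps (c i)) %/ 2)%N.

(* A has only real zeros: A splits into linear factors over R
   (the zero polynomial is included, with lead_coef 0 = 0). *)
Definition real_rooted (R : realType) (A : {poly R}) : Prop :=
  exists rs : seq R, A = lead_coef A *: \prod_(r <- rs) ('X - r%:P).

Definition sorted_zeros (R : realType) (A : {poly R}) (xs : seq R) : Prop :=
  sorted <=%R xs /\ A = lead_coef A *: \prod_(r <- xs) ('X - r%:P).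

Definition prec (R : realType) (A B : {poly R}) : Prop :=
  real_rooted A /\ real_rooted B /\
  (A = 0 \/ B = 0 \/
   exists xs ys : seq R, sorted_zeros A xs /\ sorted_zeros B ys /\
     ((size ys = (size xs).+1 /\
       forall i : nat, (i < size xs)%N ->
         ys`_i <= xs`_i /\ xs`_i <= ys`_i.+1)
      \/
      (size xs = size ys /\
       forall i : nat, (i < size xs)%N ->
         xs`_i <= ys`_i /\ ((i.+1 < size xs)%N -> ys`_i <= xs`_i.+1)))).

(* The network (V, E, ends) has underlying simple graph a cycle on n vertices
   whose spindles have sizes c_1, ..., c_n (in some cyclic arrangement). *)
Definition cycle_network (n : nat) (c : 'I_n -> nat)
    (V E : finType) (ends : E -> V * V) : Prop :=
  exists (v : 'I_n -> V) (s : {perm 'I_n}),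
    bijective v /\
    (forall e : E, exists i : 'I_n, joins ends e (v i) (v (ordS i))) /\
    (forall i : 'I_n, #|[set e : E | joins ends e (v i) (v (ordS i))]| = c (s i)).

(* Main.v *)
(* Substituting q = (u + 1) / (u - 1) in the reliability polynomial
     prod_i (1 - q^c_i) + sum_i q^c_i prod_(j <> i) (1 - q^c_j)
   of the cycle of spindles gives
     J = (n - 2) prod_i T_i + sum_i U_i prod_(j <> i) T_j,
   with T_i, U_i = ((u + 1)^c_i -/+ (u - 1)^c_i) / 2.  Each T_i and U_i is even
   or odd, T_i and U_i have opposite parities, and so J_0 and J_1 can be read off.
   In x = u^2 the quotient of the two parts of J is, up to the factor n - 2 and a
   power of x, the sum of the U_i / (u T_i).  Each of these is a partial fraction
   a + sum_k a_k / (x - y_k) with a > 0, a_k >= 0, y_k <= 0; such expressions are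
   closed under sums, and interlacing of numerator and denominator follows from
   the intermediate value theorem. *)
Require Import Defs.
From HB Require Import structures.
From mathcomp Require Import all_boot all_order all_algebra all_fingroup.
From mathcomp Require Import polyrcf ring lra zify.
From mathcomp Require Import reals.
Set Implicit Arguments. Unset Strict Implicit. Unset Printing Implicit Defensive.
Import Order.TTheory GRing.Theory Num.Theory.
Local Open Scope ring_scope.

(** * Partial fractions with nonnegative coefficients *)

Definition root_prod (R : realType) (s : seq R) : {poly R} :=
  \prod_(r <- s) ('X - r%:P).

(** Interlacing is measured by these counts: they ignore the order of the zeros, and a common zero
    changes both counts equally. *)
Definition count_le (R : realType) (t : R) (s : seq R) : nat :=
  count (fun r => r <= t) s.

Fixpoint alternates (R : realType) (p : {poly R}) (ts : seq R) : bool :=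
  if ts is t :: ts' then (0 < (-1) ^+ size ts' * p.[t]) && alternates p ts'
  else true.

Lemma root_prod_cons (R : realType) (y : R) s :
  root_prod (y :: s) = ('X - y%:P) * root_prod s.
Proof. by rewrite /root_prod big_cons. Qed.

Lemma size_root_prod (R : realType) (s : seq R) :
  size (root_prod s) = (size s).+1.
Proof. by rewrite /root_prod size_prod_XsubC. Qed.

Lemma monic_root_prod (R : realType) (s : seq R) : root_prod s \is monic.
Proof. by rewrite /root_prod monic_prod_XsubC. Qed.

Lemma perm_root_prod (R : realType) (s t : seq R) :
  perm_eq s t -> root_prod s = root_prod t.
Proof. by move=> st; apply: perm_big. Qed.

Lemma root_root_prod (R : realType) (s : seq R) x :
  root (root_prod s) x = (x \in s).
Proof. by rewrite /root_prod root_prod_XsubC. Qed.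

Lemma count_le_path0 (R : realType) (t u : R) s :
  path <%R u s -> t < u -> count_le t s = 0%N.
Proof.
move=> us tu; apply/eqP; rewrite -leqn0 leqNgt -has_count -all_predC.
apply: sub_all (order_path_min lt_trans us) => z uz /=.
by rewrite -ltNge (lt_trans tu).
Qed.

(** The intermediate value theorem puts a zero strictly between consecutive points, so zeros and
    points of [ts] alternate, starting with a zero. *)
Lemma alternates_roots (R : realType) (p : {poly R}) t0 ts :
  alternates p (t0 :: ts) -> path <%R t0 ts ->
  exists xs : seq R, [/\ size xs = size ts, path <%R t0 xs, all (root p) xs
    & forall t, (count_le t ts <= count_le t xs <= (count_le t ts).+1)%N].
Proof.
elim: ts t0 => [|t1 ts IH] t0 /=; first by move=> _ _; exists [::].
move=> /and3P[pt0 pt1 alt] /andP[t01 pts].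
have [|xs [sxs pxs rxs cxs]] := IH t1 _ pts; first by rewrite /= pt1.
have [||r] := @poly_ivtoo _ p t0 t1; first exact: ltW.
  have := mulr_gt0 pt0 pt1; rewrite exprS.
  have -> : -1 * (-1) ^+ size ts * p.[t0] * ((-1) ^+ size ts * p.[t1])
    = - (((-1) ^+ size ts) ^+ 2 * (p.[t0] * p.[t1])) by ring.
  by rewrite sqrr_sign mul1r oppr_gt0.
rewrite in_itv /= => /andP[t0r rt1] rr.
have prx : path <%R r xs.
  by case: (xs) pxs => //= a l /andP[ta ->]; rewrite (lt_trans rt1 ta).
exists (r :: xs); split => //=; rewrite ?sxs ?t0r ?rr // => t.
case: (leP t1 t) => [t1t|tt1].
  by rewrite (ltW (lt_le_trans rt1 t1t)) /= !add1n !ltnS; apply: cxs.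
rewrite (count_le_path0 pts tt1) (count_le_path0 pxs tt1).
by case: (r <= t).
Qed.

(* [numer al s / root_prod (unzip1 s)] is [al] plus the sum of the
   [x.2 / ('X - x.1)] for [x] in [s]. *)
Fixpoint numer (R : realType) (al : R) (s : seq (R * R)) : {poly R} :=
  if s is x :: s' then
    ('X - (x.1)%:P) * numer al s' + x.2 *: root_prod (unzip1 s')
  else al%:P.

Lemma numer_rem (R : realType) (al : R) s x :
  x \in s -> numer al s = numer al (x :: rem x s).
Proof.
elim: s => // y s IH; rewrite inE /=; have [->//|xy /= xs] := eqVneq x y.
rewrite IH //=.
have -> : root_prod (unzip1 s) = ('X - x.1%:P) * root_prod (unzip1 (rem x s)).
  by rewrite -root_prod_cons; apply: perm_root_prod (perm_map _ (perm_to_rem xs)).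
rewrite root_prod_cons -!mul_polyC; ring.
Qed.

Lemma perm_numer (R : realType) (al : R) s t :
  perm_eq s t -> numer al s = numer al t.
Proof.
elim: s t => [|x s IH] t st; first by move: st; rewrite perm_sym => /perm_nilP ->.
have xt : x \in t by rewrite -(perm_mem st) mem_head.
have st' : perm_eq s (rem x t).
  by rewrite -(perm_cons x) (permPl st) perm_to_rem.
rewrite (numer_rem al xt) /= (IH _ st').
by rewrite (perm_root_prod (perm_map fst st')).
Qed.

Lemma size_lead_numer (R : realType) (al : R) s : 0 < al ->
  size (numer al s) = (size s).+1 /\ lead_coef (numer al s) = al.
Proof.
move=> al0; elim: s => [|[y a] s [IHs IHl]] /=.
  by rewrite lead_coefC size_polyC gt_eqF.
have n0 : numer al s != 0 by rewrite -size_poly_gt0 IHs.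
have sM : size (('X - y%:P) * numer al s) = (size s).+2.
  by rewrite size_monicM ?monicXsubC // size_XsubC IHs.
have lt : (size (a *: root_prod (unzip1 s))%R < size (('X - y%:P) * numer al s)%R)%N.
  by rewrite sM ltnS (leq_trans (size_scale_leq _ _)) // size_root_prod size_map.
by rewrite size_polyDl // lead_coefDl // sM lead_coefM lead_coefXsubC mul1r.
Qed.

Lemma horner_root_prod_gt0 (R : realType) (x : R) s :
  path <%R x s -> 0 < (-1) ^+ size s * (root_prod s).[x].
Proof.
move=> xs; have := order_path_min lt_trans xs => {xs}.
elim: s => [_|y s IH /= /andP[xy /IH]]; first by rewrite /root_prod big_nil !hornerE.
rewrite root_prod_cons hornerM hornerXsubC exprS.
have -> : -1 * (-1) ^+ size s * ((x - y) * (root_prod s).[x])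
  = (y - x) * ((-1) ^+ size s * (root_prod s).[x]) by ring.
by apply: mulr_gt0; rewrite subr_gt0.
Qed.

Lemma alternates_step (R : realType) (p q : {poly R}) y ts :
  all (fun t => y < t) ts -> all (root q) ts -> alternates p ts ->
  alternates (('X - y%:P) * p + q) ts.
Proof.
elim: ts => //= t ts IH /andP[yt yts] /andP[/rootP qt qts] /andP[pt pts].
rewrite IH // andbT hornerD qt hornerM hornerXsubC addr0 mulrCA.
by rewrite mulr_gt0 ?subr_gt0.
Qed.

(** At a pole only the term with that pole's coefficient survives, and the product over the other
    poles has one negative factor for each larger pole. *)
Lemma alternates_numer (R : realType) (al : R) s :
  sorted <%R (unzip1 s) -> all (fun x : R * R => 0 < x.2) s ->
  alternates (numer al s) (unzip1 s).
Proof.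
elim: s => //= -[y a] s IH /= ys /andP[a0 sa].
apply/andP; split.
  rewrite hornerD hornerM hornerXsubC subrr mul0r add0r hornerZ mulrCA.
  by rewrite mulr_gt0 // horner_root_prod_gt0.
apply: alternates_step; first exact: order_path_min lt_trans ys.
  by apply/allP => t ts; apply/rootP; rewrite hornerZ (rootP _) ?mulr0 // root_root_prod.
by apply: IH => //; apply: path_sorted ys.
Qed.

Lemma sign_at_minfty (R : realType) (p : {poly R}) (M : R) : 0 < lead_coef p ->
  exists2 t, t < M & 0 < (-1) ^+ (size p).-1 * p.[t].
Proof.
(* Reflection turns minus infinity into plus infinity; the sign keeps the leading coefficient of
   [p]. *)
move=> lp; pose q := (-1) ^+ (size p).-1 *: (p \Po (- 'X)).
have lq : lead_coef q = lead_coef p.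
  rewrite lead_coefZ lead_coef_comp ?size_polyN ?size_polyX //.
  by rewrite lead_coefN lead_coefX mulrCA -exprMn mulrNN mulr1 expr1n mulr1.
have [|N HN] := @poly_pinfty_gt_lc _ q; first by rewrite lq.
pose x := Num.max N (1 - M); exists (- x).
  by have : 1 - M <= x by [rewrite /x le_max lexx orbT]; lra.
have : N <= x by rewrite /x le_max lexx.
move=> /HN; rewrite lq hornerZ horner_comp hornerN hornerX.
exact: lt_le_trans.
Qed.

Lemma nuniq_map_perm (T U : eqType) (f : T -> U) (s : seq T) : ~~ uniq (map f s) ->
  exists x y s', perm_eq s (x :: y :: s') /\ f x = f y.
Proof.
elim: s => //= x s IH; rewrite negb_and negbK => /orP[/mapP[y ys xy]|/IH].
  by exists x, y, (rem y s); rewrite perm_cons perm_to_rem.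
move=> [a [b [s' [ss' ab]]]]; exists a, b, (x :: s'); split => //.
rewrite -(perm_cons x) in ss'; apply: perm_trans ss' _.
by apply/permPl; apply: (perm_catCA [:: x] [:: a; b] s').
Qed.

(* Zero coefficients and coinciding poles both split off a factor common to
   numerator and denominator; otherwise the numerator alternates in sign at the
   poles. *)
Lemma numer_split (R : realType) (al : R) s : 0 < al -> all (fun x : R * R => 0 <= x.2) s ->
  exists xs : seq R, [/\ size xs = size s, numer al s = al *: root_prod xs
    & forall t, (count_le t (unzip1 s) <= count_le t xs
                  <= (count_le t (unzip1 s)).+1)%N].
Proof.
move=> al0; have [n] := ubnP (size s); elim: n s => // n IH s ns sa.
(* A common factor ['X - y] raises both counts equally, so the induction hypothesis for [s1]
   suffices. *)
have common y s1 : (size s1).+1 = size s -> all (fun x : R * R => 0 <= x.2) s1 ->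
    perm_eq (unzip1 s) (y :: unzip1 s1) ->
    numer al s = ('X - y%:P) * numer al s1 -> 
  exists xs : seq R, [/\ size xs = size s, numer al s = al *: root_prod xs
    & forall t, (count_le t (unzip1 s) <= count_le t xs
                  <= (count_le t (unzip1 s)).+1)%N].
  move=> ss1 sa1 ps1 ->; have [||xs [sxs -> cxs]] := IH s1 => //.
    by rewrite -ltnS ss1.
  exists (y :: xs); split => [/=||t]; first by rewrite sxs.
    by rewrite root_prod_cons -scalerAr.
  rewrite /count_le (seq.permP ps1) /=; have := cxs t; rewrite /count_le.
  by rewrite -addnS !leq_add2l.
have [/hasP[x xs /eqP x0]|] := boolP (has (fun x : R * R => x.2 == 0) s).
  apply: (common x.1 (rem x s)).
  - by rewrite size_rem // prednK //; case: (s) xs.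
  - by apply/allP => z /mem_rem; apply: (allP sa).
  - by rewrite (perm_map fst (perm_to_rem xs)).
  - by rewrite (numer_rem al xs) /= x0 scale0r addr0.
move=> s0.
have [us|/nuniq_map_perm[[y a] [[y' b] [s' [ss' /= yy']]]]] := boolP (uniq (unzip1 s)); last first.
  subst y'; have sz := perm_size ss'; rewrite /= in sz.
  move: sa; rewrite (perm_all _ ss') /= => /and3P[a0 b0 sa].
  (* Two terms over one pole merge, leaving a spare common factor. *)
  apply: (common y ((y, a + b) :: s')); first by rewrite sz.
  - by rewrite /= addr_ge0.
  - by rewrite (perm_map fst ss').
  - by rewrite (perm_numer al ss') /= root_prod_cons -!mul_polyC polyCD; ring.
pose s1 := sort (fun x y : R * R => x.1 <= y.1) s.
have ss1 : perm_eq s1 s by rewrite perm_sort.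
have u1 : sorted <%R (unzip1 s1).
  rewrite lt_sorted_uniq_le (perm_uniq (perm_map fst ss1)) us /=.
  rewrite sorted_map; apply: sort_sorted => x y; exact: le_total.
have a1 : all (fun x : R * R => 0 < x.2) s1.
  rewrite (perm_all _ ss1); apply/allP => x xs; rewrite lt0r (allP sa) // andbT.
  by move/hasPn: s0 => /(_ _ xs).
have alt := alternates_numer al u1 a1.
have [sN lN] := size_lead_numer s1 al0.
rewrite -(perm_numer al ss1) -(perm_size ss1).
(* The gaps between the poles give one zero too few; a point far to the left supplies the missing
   sign change. *)
have [t0 t0h pt0] : exists2 t0, path <%R t0 (unzip1 s1) & 0 < (-1) ^+ (size (numer al s1)).-1 * (numer al s1).[t0].
  have [|t0 h1 h2] := @sign_at_minfty _ (numer al s1) (head 0 (unzip1 s1)); first by rewrite lN.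
  by exists t0 => //; case: (unzip1 s1) u1 h1 => //= a l -> ->.
have [|xs [sxs pxs rxs cxs]] := @alternates_roots _ (numer al s1) _ _ _ t0h.
  by rewrite /= alt andbT; move: pt0; rewrite sN size_map.
rewrite size_map in sxs; exists xs; split => //; last first.
  by move=> t; rewrite /count_le -(seq.permP (perm_map fst ss1)); apply: cxs.
rewrite -{2}lN; apply: all_roots_prod_XsubC => //; first by rewrite sN sxs.
by rewrite uniq_rootsE; apply: lt_sorted_uniq (path_sorted pxs).
Qed.

(** * The partial fractions of the binomial parts *)

Lemma numerD (R : realType) (al be : R) t :
  numer (al + be) t = al *: root_prod (unzip1 t) + numer be t.
Proof.
elim: t => [|x t IH] /=; first by rewrite /root_prod big_nil polyCD alg_polyC.
rewrite IH root_prod_cons -!mul_polyC; ring.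
Qed.

Lemma numer_cat (R : realType) (al be : R) s t :
  numer (al + be) (s ++ t) =
  numer al s * root_prod (unzip1 t) + root_prod (unzip1 s) * numer be t.
Proof.
elim: s => [|x s IH] /=.
  by rewrite numerD /root_prod big_nil mul1r mul_polyC.
rewrite IH root_prod_cons /unzip1 map_cat /root_prod big_cat /= -!mul_polyC; ring.
Qed.

(* [A / B] is [al] plus a sum of terms [a / (x - y)] with [a >= 0] and [y <= 0]. *)
Definition stieltjes (R : realType) (al : R) (A B : {poly R}) : Prop :=
  exists (s : seq (R * R)) (b : R),
    [/\ 0 < b, all (fun x : R * R => (0 <= x.2) && (x.1 <= 0)) s,
        A = b *: numer al s & B = b *: root_prod (unzip1 s)].

Lemma stieltjes01 (R : realType) : @stieltjes R 0 0 1.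
Proof.
exists [::], 1; split => //=; first by rewrite scaler0.
by rewrite /root_prod big_nil scale1r.
Qed.

Lemma stieltjesD (R : realType) (al be : R) A B C D :
  stieltjes al A B -> stieltjes be C D ->
  stieltjes (al + be) (A * D + B * C) (B * D).
Proof.
move=> [s [b [b0 sa -> ->]]] [t [d [d0 ta -> ->]]].
exists (s ++ t), (b * d); split; first exact: mulr_gt0.
- by rewrite all_cat sa.
- rewrite numer_cat -!mul_polyC polyCM; ring.
- rewrite /unzip1 map_cat /root_prod big_cat /= -!mul_polyC polyCM; ring.
Qed.

Lemma stieltjes_addr (R : realType) (al : R) A B :
  stieltjes al A B -> stieltjes (al + 1) (A + B) B.
Proof.
move=> [s [b [b0 sa -> ->]]]; exists s, b; split => //.
by rewrite [al + 1]addrC numerD scale1r scalerDr addrC.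
Qed.

(** Nonpositivity of [ys] is kept so that a factor ['X] of [B] contributes its largest zero. *)
Definition interlaced (R : realType) (A B : {poly R}) : Prop :=
  exists (a b : R) (xs ys : seq R),
    [/\ 0 < a, 0 < b, A = a *: root_prod xs & B = b *: root_prod ys] /\
    [/\ size xs = size ys, all (<= 0) ys
      & forall t, (count_le t ys <= count_le t xs <= (count_le t ys).+1)%N].

Lemma stieltjes_interlaced (R : realType) (al : R) A B :
  0 < al -> stieltjes al A B -> interlaced A B.
Proof.
move=> al0 [s [b [b0 sa -> ->]]].
have [|xs [sxs -> cxs]] := @numer_split _ al s al0.
  by apply: sub_all sa => x /andP[].
exists (b * al), b, xs, (unzip1 s); split; split => //; first exact: mulr_gt0.
- by rewrite scalerA.
- by rewrite size_map.
- by rewrite all_map; apply: sub_all sa => x /andP[].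
Qed.

(** With D the product, the coefficient at a pole y is A(y) / D'(y), which has the sign of A(y)
    D'(y). Poles are split off one at a time. *)
Lemma partial_fractions (R : realType) (A : {poly R}) ys :
  (size A <= (size ys).+1)%N ->
  all (fun y => 0 < A.[y] * (root_prod ys)^`().[y]) ys ->
  exists s : seq (R * R), [/\ unzip1 s = ys, all (fun x : R * R => 0 <= x.2) s
    & A = numer A`_(size ys) s].
Proof.
elim: ys A => [|y ys IH] A /= sA; first by exists [::]; split => //=; rewrite [LHS]size1_polyC.
rewrite root_prod_cons => /andP[Ay Ays].
set D := root_prod ys in Ay Ays *.
have dE z : (('X - y%:P) * D)^`().[z] = D.[z] + (z - y) * D^`().[z].
  by rewrite derivM derivXsubC mul1r hornerD hornerM hornerXsubC.
rewrite dE subrr mul0r addr0 in Ay.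
have Dy : D.[y] != 0 by apply: contraTneq Ay => ->; rewrite mulr0 ltxx.
pose a := A.[y] / D.[y].
have /factor_theorem[q qE] : root (A - a *: D) y.
  by apply/rootP; rewrite hornerD hornerN hornerZ divfK // subrr.
have sD : size D = (size ys).+1 by rewrite size_root_prod.
have AE : A = ('X - y%:P) * q + a *: D by rewrite mulrC -qE subrK.
have sq : (size q <= (size ys).+1)%N.
  have [->|q0] := eqVneq q 0; first by rewrite size_poly0.
  rewrite -ltnS; have := size_Mmonic q0 (monicXsubC y); rewrite size_XsubC addn2 /= => <-.
  rewrite -qE (leq_trans (size_polyD _ _)) // geq_max sA size_polyN.
  by rewrite (leq_trans (size_scale_leq _ _)) // sD.
have lq : q`_(size ys) = A`_(size ys).+1.
  rewrite AE coefD coefZ [D`__]nth_default ?sD // mulr0 addr0 mulrBl coefB coefXM /=.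
  by rewrite mul_polyC coefZ [q`_(_).+1]nth_default // mulr0 subr0.
(* At another pole [z], both [A] and the derivative of the full product carry a factor [z - y];
   removing its square passes the sign condition to [q]. *)
have [|s [sys sa qN]] := IH q sq.
  apply/allP => z zs; have := allP Ays z zs; rewrite dE -/D.
  have Dz : D.[z] = 0 by apply/rootP; rewrite root_root_prod.
  rewrite AE hornerD hornerZ hornerM hornerXsubC Dz mulr0 add0r addr0.
  rewrite mulrACA -expr2 => h.
  by rewrite -(pmulr_rgt0 _ (_ : 0 < (z - y) ^+ 2)) // lt0r sqr_ge0 andbT; apply: contraTneq h => ->; rewrite mul0r ltxx.
exists ((y, a) :: s); split => /=; first by rewrite sys.
  have -> : a = A.[y] * D.[y] / D.[y] ^+ 2 by rewrite /a; field.
  by rewrite sa andbT divr_ge0 ?sqr_ge0 // ltW.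
by rewrite -lq -qN sys.
Qed.

Section BinomialParts.
Variable R : realType.
Local Notation Ep := (Epoly R).
Local Notation Op := (Opoly R).

Lemma EpolyS c : Ep c.+1 = Ep c + 'X * Op c.
Proof.
by rewrite /Epoly /Opoly exprSr mulrDr mulr1 even_polyD even_polyMX addrC [_ * 'X]mulrC.
Qed.

Lemma OpolyS c : Op c.+1 = Ep c + Op c.
Proof. by rewrite /Epoly /Opoly exprSr mulrDr mulr1 odd_polyD odd_polyMX. Qed.

Lemma Epoly0 : Ep 0 = 1. Proof. by rewrite /Epoly expr0 even_polyC. Qed.
Lemma Opoly0 : Op 0 = 0. Proof. by rewrite /Opoly expr0 odd_polyC. Qed.

(* Even and odd parts of [(u + 1) * ((u + 1)^c)' = c * (u + 1)^c]. *)
Lemma deriv_parts c :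
  2 *: ((1 - 'X) * (Ep c)^`()) = c%:R *: (Op c - Ep c) /\
  2 *: ((1 - 'X) * ('X * (Op c)^`())) =
    c%:R *: (Ep c - 'X * Op c) - (1 - 'X) * Op c.
Proof.
elim: c => [|c [IHe IHo]].
  by rewrite Epoly0 Opoly0 !derivE !(mulr0, scale0r, scaler0, subr0).
rewrite EpolyS OpolyS !derivD derivM derivX mul1r; split.
  transitivity (2 *: ((1 - 'X) * (Ep c)^`()) + 2 *: ((1 - 'X) * Op c)
     + 2 *: ((1 - 'X) * ('X * (Op c)^`()))); first by rewrite -!mul_polyC; ring.
  by rewrite IHe IHo -!mul_polyC !polyC_natr; ring.
transitivity ('X * (2 *: ((1 - 'X) * (Ep c)^`()))
     + 2 *: ((1 - 'X) * ('X * (Op c)^`()))); first by rewrite -!mul_polyC; ring.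
by rewrite IHe IHo -!mul_polyC !polyC_natr; ring.
Qed.

(** This is (1 + u)^c (1 - u)^c in terms of x = u^2; hence the two parts have no common zero except
    possibly 1. *)
Lemma norm_parts c : Ep c ^+ 2 - 'X * Op c ^+ 2 = (1 - 'X) ^+ c.
Proof.
elim: c => [|c IH]; first by rewrite Epoly0 Opoly0 expr0; ring.
by rewrite EpolyS OpolyS [RHS]exprS -IH; ring.
Qed.

Lemma parts_at0 c : (Ep c).[0] = 1 /\ (Op c).[0] = c%:R.
Proof.
elim: c => [|c [IHe IHo]]; first by rewrite Epoly0 Opoly0 !hornerE.
by rewrite EpolyS OpolyS !hornerE IHe IHo ?(mul0r, addr0) -natr1 addrC.
Qed.

(** With x = u^2, the quotient of [num_part c] by [den_part c] is U / (u T) for a spindle of size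
    [c]. *)
Definition num_part c : {poly R} := if odd c then Op c else Ep c.
Definition den_part c : {poly R} := if odd c then Ep c else 'X * Op c.

(** Up to a factor ['X], the next denominator is the numerator of the present quotient plus one;
    this drives the induction locating its zeros. *)
Lemma den_partS c :
  den_part c.+1 = (if odd c then 'X else 1) * (num_part c + den_part c).
Proof.
rewrite /den_part /num_part /= EpolyS OpolyS.
by case: (odd c) => /=; rewrite ?mul1r // addrC.
Qed.

Lemma coef_num_part c k : (num_part c)`_k = ((('X : {poly R}) + 1) ^+ c)`_(odd c + k.*2).
Proof. by rewrite /num_part; case: (odd c); rewrite /Epoly /Opoly !coefE. Qed.

Lemma size_X1n c : size (((('X : {poly R}) + 1) ^+ c)) = c.+1.
Proof. by rewrite -[1]opprK -polyCN size_exp_XsubC. Qed.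

Lemma lead_num_part c : (num_part c)`_(c./2) = 1.
Proof.
rewrite coef_num_part odd_double_half.
have /monicP : (('X : {poly R}) + 1) ^+ c \is monic.
  by rewrite -[1]opprK -polyCN monic_exp // monicXsubC.
by rewrite lead_coefE size_X1n.
Qed.

Lemma size_num_part c : (size (num_part c) <= (c./2).+1)%N.
Proof.
apply/leq_sizeP => k ck; rewrite coef_num_part nth_default // size_X1n.
by have := odd_double_half c; lia.
Qed.

(** At a zero of the factor [Epoly] or [Opoly], [deriv_parts] makes the product [c] times the square
    of the other part over 2(1 - y), and [norm_parts] makes this square nonzero. *)
Lemma residue_gt0 c y : (0 < c)%N -> y <= 0 -> root (den_part c) y ->
  0 < (num_part c).[y] * (den_part c)^`().[y].
Proof.
move=> c0 y0 /rootP By.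
have h1 : (1 : {poly R}).[y] = 1 by rewrite hornerE.
pose hE := (hornerD, hornerN, hornerZ, hornerM, hornerX, horner_exp, h1).
have [/(congr1 (horner^~ y)) dE /(congr1 (horner^~ y)) dO] := deriv_parts c.
have /(congr1 (horner^~ y)) N := norm_parts c.
have y1 : 0 < 1 - y by lra.
have cR : 0 < c%:R :> R by rewrite ltr0n.
have yc : 0 < (1 - y) ^+ c by rewrite exprn_gt0.
have two : 0 < 2 * (1 - y) by rewrite mulr_gt0 // ltr0n.
rewrite -(pmulr_rgt0 _ two).
move: By; rewrite /num_part /den_part; case: (odd c).
  move=> Ey; move: dE N; rewrite !hE Ey.
  set o := (Op c).[y]; set e' := _^`().[y] => dE N.
  have -> : 2 * (1 - y) * (o * e') = c%:R * o ^+ 2.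
    by transitivity (o * (2 * ((1 - y) * e'))); [ring|rewrite dE; ring].
  rewrite mulr_gt0 // lt0r sqr_ge0 andbT sqrf_eq0.
  by apply: contraTneq yc => o0; rewrite -N o0; lra.
rewrite derivM derivX mul1r; move: dO N; rewrite !hE.
set o := (Op c).[y]; set e := (Ep c).[y]; set o' := _^`().[y] => dO N yo.
have -> : 2 * (1 - y) * (e * (o + y * o')) = e * o * (1 - y) + c%:R * e ^+ 2.
  transitivity (e * (2 * (1 - y) * o + 2 * ((1 - y) * (y * o')))); first by ring.
  by rewrite dO yo; ring.
(* For even [c] the factor ['X] adds the zero 0, where the parts take the values 1 and [c]. *)
move/eqP: yo; rewrite mulf_eq0 => /orP[/eqP yz|/eqP o0].
  have [e1 o1] := parts_at0 c.
  rewrite /o /e yz e1 o1; nra.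
rewrite o0 mulr0 mul0r add0r mulr_gt0 // lt0r sqr_ge0 andbT sqrf_eq0.
by apply: contraTneq yc => e0; rewrite -N o0 e0; lra.
Qed.

(** Induction on [c]: by [den_partS] and interlacing the next denominator has real nonpositive
    zeros, and then [residue_gt0] gives its partial fractions. *)
Lemma stieltjes_parts c : (0 < c)%N ->
  exists2 al, 0 < al & stieltjes al (num_part c) (den_part c).
Proof.
have main c' ys b : (0 < c')%N -> 0 < b -> all (<= 0) ys -> size ys = c'./2 ->
    den_part c' = b *: root_prod ys ->
    exists2 al, 0 < al & stieltjes al (num_part c') (den_part c').
  move=> c0 b0 ys0 sys BE.
  have [||s [sE sa sN]] := @partial_fractions _ (b^-1 *: num_part c') ys.
  - by rewrite sys (leq_trans (size_scale_leq _ _)) // size_num_part.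
  - apply/allP => y yin; rewrite hornerZ.
    have yB : root (den_part c') y by rewrite BE rootZ ?gt_eqF // root_root_prod.
    have := residue_gt0 c0 (allP ys0 y yin) yB.
    rewrite BE derivZ hornerZ -mulrA => h; rewrite mulr_gt0 ?invr_gt0 //.
    by rewrite mulrCA pmulr_rgt0 in h.
  exists b^-1; first by rewrite invr_gt0.
  exists s, b; split => //.
  - apply/allP => x xs; rewrite (allP sa) //=.
    by apply: (allP ys0); rewrite -sE map_f.
  - rewrite coefZ sys lead_num_part mulr1 in sN.
    by rewrite -sN scalerA divff ?gt_eqF // scale1r.
  - by rewrite sE.
move=> c0; suff [b [ys [b0 ys0 sys BE]]] : exists b ys,
  [/\ 0 < b, all (<= 0) ys, size ys = c./2 & den_part c = b *: root_prod ys].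
  exact: main c0 b0 ys0 sys BE.
case: c c0 => // c _; elim: c => [|c [b [ys [b0 ys0 sys BE]]]].
  exists 1, [::]; split => //.
  by rewrite /den_part /= EpolyS Epoly0 Opoly0 mulr0 addr0 /root_prod big_nil scale1r.
have [//|al al0 st] := main c.+1 ys b _ b0 ys0 sys BE.
have [|a [b' [xs [ys' [[a0 b'0 AE BE']]]]]] := stieltjes_interlaced _ (stieltjes_addr st).
  by rewrite addr_gt0.
move=> [sxs ys'0 cxs].
have sys' : size ys' = (c.+1)./2.
  have := congr1 (fun p : {poly R} => size p) BE'.
  by rewrite {1}BE !size_scale ?gt_eqF // !size_root_prod sys => -[<-].
(* At 0 all zeros of the denominator are counted, hence all those of the numerator. *)
have xs0 : all (<= 0) xs.
  have /andP[h _] := cxs 0; rewrite all_count eqn_leq count_size /=.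
  by move: ys'0 h; rewrite all_count /count_le sxs => /eqP ->.
rewrite den_partS AE.
exists a, (if odd c.+1 then 0 :: xs else xs); split => //.
- by case: ifP => //= _; rewrite lexx.
- by case: ifP => /= oc; rewrite sxs sys'; lia.
- by case: ifP => _; rewrite ?mul1r // root_prod_cons subr0 scalerAr.
Qed.

End BinomialParts.

(** * Interlacing *)

Lemma nth_le_count (R : realType) (s : seq R) t i : sorted <=%R s ->
  (i < size s)%N -> (s`_i <= t) = (i < count_le t s)%N.
Proof.
move=> ss si; case: (ltnP i (count_le t s)) => h; first exact: nth_count_le.
by apply/negbTE; rewrite -ltNge; apply: nth_count_gt => //; rewrite h.
Qed.

Lemma sorted_zeros_sort (R : realType) (a : R) xs :
  sorted_zeros (a *: root_prod xs) (sort <=%R xs).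
Proof.
split; first exact: sort_le_sorted.
rewrite lead_coefZ (monicP (monic_root_prod xs)) mulr1; congr (_ *: _).
by apply: perm_root_prod; rewrite perm_sym perm_sort.
Qed.

Lemma real_rooted_root_prod (R : realType) (a : R) xs :
  real_rooted (a *: root_prod xs).
Proof. by exists (sort <=%R xs); case: (sorted_zeros_sort a xs). Qed.

Lemma count_le_sort (R : realType) (t : R) xs :
  count_le t (sort <=%R xs) = count_le t xs.
Proof. by rewrite /count_le count_sort. Qed.

Lemma count_le_nth_gt (R : realType) (s : seq R) i : sorted <=%R s ->
  (i < size s)%N -> (i < count_le s`_i s)%N.
Proof. by move=> ss si; rewrite -nth_le_count. Qed.

Lemma interlaced_prec (R : realType) (A B : {poly R}) :
  interlaced A B -> prec A B.
Proof.
move=> [a [b [xs [ys [[a0 b0 -> ->] [sxy _ cxy]]]]]].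
split; first exact: real_rooted_root_prod.
split; first exact: real_rooted_root_prod.
right; right; exists (sort <=%R xs), (sort <=%R ys).
split; first exact: sorted_zeros_sort.
split; first exact: sorted_zeros_sort.
right; rewrite !size_sort; split=> // i ix.
have sx := sort_le_sorted xs; have sy := sort_le_sorted ys.
have iy : (i < size ys)%N by rewrite -sxy.
split=> [|ix1].
  rewrite nth_le_count ?size_sort // count_le_sort.
  have := @count_le_nth_gt _ _ i sy; rewrite size_sort count_le_sort => /(_ iy) h.
  by have /andP[h1 _] := cxy (sort <=%R ys)`_i; apply: leq_trans h h1.
rewrite nth_le_count ?size_sort // count_le_sort.
have := @count_le_nth_gt _ _ i.+1 sx; rewrite size_sort count_le_sort => /(_ ix1) h.
by have /andP[_ h1] := cxy (sort <=%R xs)`_i.+1; rewrite -ltnS (leq_trans h h1).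
Qed.

Lemma root_prod_mulX (R : realType) (a : R) xs (A : {poly R}) : 0 < a ->
  'X * A = a *: root_prod xs -> 0 \in xs /\ A = a *: root_prod (rem 0 xs).
Proof.
move=> a0 AE; have x0 : 0 \in xs.
  rewrite -root_root_prod -(rootZ _ _ (lt0r_neq0 a0)) -AE.
  by apply/rootP; rewrite hornerM hornerX mul0r.
split=> //; apply: (@mulfI _ 'X); first by rewrite polyX_eq0.
rewrite AE.
by rewrite (perm_root_prod (perm_to_rem x0)) root_prod_cons subr0 scalerAr.
Qed.

(* All zeros of [B] are nonpositive, so [0] is the largest zero of ['X * B]. *)
Lemma interlaced_mulX_prec (R : realType) (A B : {poly R}) :
  interlaced A ('X * B) -> prec B A.
Proof.
move=> [a [b [xs [zs [[a0 b0 -> BE] [sxz z0 cxz]]]]]].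
have [zs0 ->] := root_prod_mulX b0 BE.
set ys := rem 0 zs; have pz : perm_eq zs (0 :: ys) := perm_to_rem zs0.
have sxy : size xs = (size ys).+1 by rewrite sxz (perm_size pz).
have ys0 : all (<= 0) ys by apply/allP => y /mem_rem; apply: (allP z0).
(* Dropping the zero 0 changes the count only for [t >= 0], where all of [ys] is counted and [xs]
   has just one element more. *)
have cxy t : (count_le t ys <= count_le t xs <= (count_le t ys).+1)%N.
  have := cxz t; rewrite /count_le (seq.permP pz) /= -/(count_le t xs) -/(count_le t ys).
  case: (leP 0 t) => [t0|_]; last by rewrite add0n.
  have -> : count_le t ys = size ys.
    apply/eqP; rewrite -all_count; apply: sub_all ys0 => y /= y0; apply: le_trans y0 t0.
  by rewrite -sxy /count_le count_size add1n => /andP[/ltnW ->].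
split; first exact: real_rooted_root_prod.
split; first exact: real_rooted_root_prod.
right; right; exists (sort <=%R ys), (sort <=%R xs).
split; first exact: sorted_zeros_sort.
split; first exact: sorted_zeros_sort.
left; rewrite !size_sort; split=> // i iy.
have sx := sort_le_sorted xs; have sy := sort_le_sorted ys.
have ix : (i.+1 < size xs)%N by rewrite sxy ltnS.
split.
  rewrite nth_le_count ?size_sort ?(ltnW ix) // count_le_sort.
  have := @count_le_nth_gt _ _ i sy; rewrite size_sort count_le_sort => /(_ iy) h.
  by have /andP[h1 _] := cxy (sort <=%R ys)`_i; apply: leq_trans h h1.
rewrite nth_le_count ?size_sort // count_le_sort.
have := @count_le_nth_gt _ _ i.+1 sx; rewrite size_sort count_le_sort => /(_ ix) h.
by have /andP[_ h1] := cxy (sort <=%R xs)`_i.+1; rewrite -ltnS (leq_trans h h1).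
Qed.

Lemma interlacedZr (R : realType) (k : R) A B :
  0 < k -> interlaced A B -> interlaced A (k *: B).
Proof.
move=> k0 [a [b [xs [ys [[a0 b0 -> ->] h]]]]].
exists a, (k * b), xs, ys; split => //; split => //; first exact: mulr_gt0.
by rewrite scalerA.
Qed.

Lemma interlaced_mulX (R : realType) (A B : {poly R}) :
  interlaced ('X * A) ('X * B) -> interlaced A B.
Proof.
move=> [a [b [xs [ys [[a0 b0 AE BE] [sxy y0 cxy]]]]]].
have [xs0 ->] := root_prod_mulX a0 AE; have [ys0 ->] := root_prod_mulX b0 BE.
exists a, b, (rem 0 xs), (rem 0 ys); split; split => //.
- by rewrite !size_rem // sxy.
- by apply/allP => y /mem_rem; apply: (allP y0).
move=> t; have := cxy t; rewrite /count_le.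
rewrite (seq.permP (perm_to_rem xs0)) (seq.permP (perm_to_rem ys0)) /=.
by rewrite -addnS !leq_add2l.
Qed.

Lemma interlaced_mulXn (R : realType) h (A B : {poly R}) :
  interlaced ('X^h * A) ('X^h * B) -> interlaced A B.
Proof.
elim: h A B => [|h IH] A B; first by rewrite !mul1r.
by rewrite !exprSr -!mulrA => /IH /interlaced_mulX.
Qed.

(** The quotients are added over a common denominator; [?= iff] records that the constant is
    positive as soon as there is a summand. *)
Lemma stieltjes_sum (R : realType) (I : eqType) (F G : I -> {poly R}) (r : seq I) :
  uniq r -> (forall i, exists2 al, 0 < al & stieltjes al (F i) (G i)) ->
  exists2 al, 0 <= al ?= iff (size r == 0)%N &
    stieltjes al (\sum_(i <- r) F i * \prod_(j <- r | j != i) G j)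
                 (\prod_(i <- r) G i).
Proof.
move=> + st; elim: r => [|i r IH] /=.
  move=> _; exists 0; last by rewrite !big_nil; apply: stieltjes01.
  by split; rewrite ?lexx ?eqxx.
move=> /andP[ir /IH[be be0 IHr]]; have [al al0 sti] := st i.
exists (al + be).
  by apply/leifP => /=; rewrite ltr_pwDl // be0.
rewrite big_cons [\prod_(j <- _ | j != i) _]big_cons [\prod_(j <- i :: r) _]big_cons eqxx /=.
have -> : \prod_(j <- r | j != i) G j = \prod_(j <- r) G j.
  rewrite big_seq_cond [RHS]big_seq; apply: eq_bigl => j.
  by have [jr|] := boolP (j \in r) => //=; apply: contraNneq ir => <-.
have -> : \sum_(k <- r) F k * \prod_(j <- i :: r | j != k) G j =
          G i * \sum_(k <- r) F k * \prod_(j <- r | j != k) G j.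
  rewrite mulr_sumr big_seq [RHS]big_seq; apply: eq_bigr => k kr.
  by rewrite big_cons ifT 1?mulrCA //; apply: contraNneq ir => ->.
exact: stieltjesD.
Qed.

(** * Even and odd parts of J *)

(* With [q = (u + 1) / (u - 1)], these are [(u - 1)^c (q^c -/+ 1) / 2] at [u]. *)
Definition half_diff (R : realType) (c : nat) : {poly R} :=
  2^-1 *: (('X + 1) ^+ c - ('X - 1) ^+ c).
Definition half_sum (R : realType) (c : nat) : {poly R} :=
  2^-1 *: (('X + 1) ^+ c + ('X - 1) ^+ c).

Lemma Xadd1n_parts (R : realType) c :
  ('X + 1) ^+ c = (Epoly R c \Po 'X^2) + 'X * (Opoly R c \Po 'X^2).
Proof. by rewrite -[LHS]poly_even_odd [_ * 'X]mulrC. Qed.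

Lemma Xsub1n_parts (R : realType) c :
  ('X - 1) ^+ c =
  (-1) ^+ c * ((Epoly R c \Po 'X^2) - 'X * (Opoly R c \Po 'X^2)).
Proof.
elim: c => [|c IH].
  by rewrite Epoly0 Opoly0 comp_poly0 -polyC1 comp_polyC polyC1 !expr0; ring.
rewrite exprS IH EpolyS OpolyS !comp_polyD comp_polyM comp_polyX !exprS; ring.
Qed.

(** The half difference has parity opposite to [c], so the extra power of u makes it even; the same
    power makes the half sum odd. *)
Lemma half_diffE (R : realType) c :
  'X^(eps c) * half_diff R c = den_part R c \Po 'X^2.
Proof.
rewrite /half_diff Xadd1n_parts Xsub1n_parts /eps /den_part -signr_odd.
set e := _ \Po _; set o := _ \Po 'X^2; have h2 : (2 : R) != 0 by rewrite pnatr_eq0.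
case: (odd c) => /=.
  have -> : e + 'X * o - (-1) ^+ 1 * (e - 'X * o) = (2 : R) *: e.
    by rewrite -mul_polyC polyC_natr; ring.
  by rewrite scalerA mulVf // scale1r mul1r.
have -> : e + 'X * o - (-1) ^+ 0 * (e - 'X * o) = (2 : R) *: ('X * o).
  by rewrite -mul_polyC polyC_natr; ring.
by rewrite scalerA mulVf // scale1r comp_polyM comp_polyX mulrA -expr2.
Qed.

Lemma half_sumE (R : realType) c :
  'X^(eps c) * half_sum R c = 'X * (num_part R c \Po 'X^2).
Proof.
rewrite /half_sum Xadd1n_parts Xsub1n_parts /eps /num_part -signr_odd.
set e := _ \Po _; set o := _ \Po 'X^2; have h2 : (2 : R) != 0 by rewrite pnatr_eq0.
case: (odd c) => /=.
  have -> : e + 'X * o + (-1) ^+ 1 * (e - 'X * o) = (2 : R) *: ('X * o).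
    by rewrite -mul_polyC polyC_natr; ring.
  by rewrite scalerA mulVf // scale1r mul1r.
have -> : e + 'X * o + (-1) ^+ 0 * (e - 'X * o) = (2 : R) *: e.
  by rewrite -mul_polyC polyC_natr; ring.
by rewrite scalerA mulVf // scale1r.
Qed.

Lemma den_partE (R : realType) c : den_part R c = 'X^(eps c) * Spoly R c.
Proof. by rewrite /den_part /eps /Spoly; case: (odd c); rewrite ?mul1r. Qed.

Lemma even_poly_comp_X2 (R : realType) (A : {poly R}) : even_poly (A \Po 'X^2) = A.
Proof.
apply/polyP => i; rewrite coef_even_poly coef_comp_poly_Xn // dvdn2 odd_double.
by rewrite /= -muln2 mulnK.
Qed.

Lemma odd_poly_comp_X2 (R : realType) (A : {poly R}) : odd_poly (A \Po 'X^2) = 0.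
Proof.
apply/polyP => i; rewrite coef_odd_poly coef_comp_poly_Xn // dvdn2 /= odd_double.
by rewrite coef0.
Qed.

Lemma even_poly_parts (R : realType) (A B : {poly R}) :
  even_poly ((A \Po 'X^2) + 'X * (B \Po 'X^2)) = A.
Proof.
by rewrite mulrC even_polyD even_polyMX even_poly_comp_X2 odd_poly_comp_X2 mul0r addr0.
Qed.

Lemma odd_poly_parts (R : realType) (A B : {poly R}) :
  odd_poly ((A \Po 'X^2) + 'X * (B \Po 'X^2)) = B.
Proof.
by rewrite mulrC odd_polyD odd_polyMX even_poly_comp_X2 odd_poly_comp_X2 add0r.
Qed.

Lemma even_polyXnM (R : realType) h (p : {poly R}) :
  even_poly ('X^(h.*2) * p) = 'X^h * even_poly p.
Proof.
apply/polyP => i; rewrite coef_even_poly !coefXnM coef_even_poly ltn_double.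
by rewrite -doubleB.
Qed.

Lemma odd_polyXnM (R : realType) h (p : {poly R}) :
  odd_poly ('X^(h.*2) * p) = 'X^h * odd_poly p.
Proof.
apply/polyP => i; rewrite coef_odd_poly !coefXnM coef_odd_poly.
have -> : (i.*2.+1 < h.*2)%N = (i < h)%N by lia.
by case: ltnP => // hi; congr (_`__); lia.
Qed.

(** The left side is the sum of the [(c i).+1], each odd exactly when [c i] is even. *)
Lemma odd_sum_eps n (c : 'I_n -> nat) :
  odd (n + \sum_(i < n) c i) = odd (\sum_(i < n) eps (c i)).
Proof.
have -> : (n + \sum_(i < n) c i)%N = (\sum_(i < n) (c i).+1)%N.
  rewrite -[X in (X + _)%N]card_ord -sum1_card -big_split /=.
  by apply: eq_bigr => i _; rewrite add1n.
rewrite !(big_morph odd oddD (erefl : odd 0 = false)).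
by apply: eq_bigr => i _; rewrite /eps /=; case: (odd _).
Qed.

Lemma cycle_parts_prec (R : realType) n (c : 'I_n -> nat) (J : {poly R}) :
  (3 <= n)%N -> (forall i, (0 < c i)%N) ->
  J = (n - 2)%:R *: \prod_(i < n) half_diff R (c i)
      + \sum_(i < n) half_sum R (c i) * \prod_(j < n | j != i) half_diff R (c j) ->
  (if odd (n + \sum_(i < n) c i) then odd_poly J else even_poly J)
    = (n - 2)%:R *: ('X ^+ nu c * \prod_(i < n) Spoly R (c i)) /\
  prec (odd_poly J) (even_poly J).
Proof.
move=> n3 c0 JE; rewrite odd_sum_eps /nu.
set e := (\sum_(i < n) eps (c i))%N.
set P := \prod_(i < n) Spoly R (c i).
set B := \prod_(i < n) den_part R (c i).
set A := \sum_(i < n) num_part R (c i) * \prod_(j < n | j != i) den_part R (c j).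
have BE : B = 'X^e * P.
  rewrite /B /e /P (eq_bigr _ (fun i _ => den_partE R (c i))) big_split /=.
  by rewrite (big_morph (fun k => 'X^k : {poly R}) (id1 := 1) (op1 := *%R) (exprD _) (expr0 _)).
(* The power u^e clears all parities at once: the product becomes even and the sum odd. *)
have XJ : 'X^e * J = (((n - 2)%:R *: B) \Po 'X^2) + 'X * (A \Po 'X^2).
  have XeE : 'X^e = \prod_(i < n) ('X^(eps (c i)) : {poly R}).
    by rewrite (big_morph (fun k => 'X^k : {poly R}) (id1 := 1) (op1 := *%R) (exprD _) (expr0 _)).
  rewrite JE mulrDr -scalerAr XeE -big_split /= comp_polyZ rmorph_prod /=.
  congr (_ *: _ + _); first by apply: eq_bigr => i _; rewrite half_diffE.
  rewrite mulr_sumr rmorph_sum mulr_sumr; apply: eq_bigr => i _.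
  rewrite (bigD1 i) //= mulrACA half_sumE -big_split /= -mulrA comp_polyM rmorph_prod /=.
  by congr (_ * (_ * _)); apply: eq_bigr => j _; rewrite half_diffE.
have k0 : 0 < (n - 2)%:R :> R by rewrite ltr0n subn_gt0.
have [al al0 st] : exists2 al : R, 0 < al & stieltjes al A B.
  have [|al [al0 al1] st] := @stieltjes_sum R _ (num_part R \o c) (den_part R \o c) (index_enum 'I_n) (index_enum_uniq _).
    by move=> i; apply: stieltjes_parts.
  exists al => //; rewrite lt0r al0 andbT eq_sym al1.
  by rewrite -sum1_size sum1_card card_ord -lt0n (leq_trans _ n3).
have AB := interlacedZr k0 (stieltjes_interlaced al0 st).
have evJ := congr1 (@even_poly R) XJ; have odJ := congr1 (@odd_poly R) XJ.
rewrite even_poly_parts in evJ; rewrite odd_poly_parts in odJ.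
rewrite divn2; have := odd_double_half e; set h := e./2 => eE.
move: AB; rewrite -evJ -odJ; move: evJ; rewrite BE.
(* After cancelling ['X^h], numerator and denominator are the even part and ['X] times the odd part
   of [J] if [e] is odd, and the odd and the even part if [e] is even. *)
case: (odd e) eE => <- /=.
  rewrite add1n exprSr -!mulrA even_polyXnM odd_polyXnM ['X * J]mulrC.
  rewrite even_polyMX odd_polyMX [_ * 'X]mulrC => evJ.
  move=> /interlaced_mulXn /interlaced_mulX_prec; split => //.
  apply: (@mulfI _ ('X^h * 'X)); first by rewrite mulf_neq0 ?polyX_eq0 ?expf_neq0 ?polyX_eq0.
  rewrite -mulrA evJ -scalerAr -!mul_polyC; congr (_ * _).
  rewrite -addnn exprD; ring.
rewrite add0n even_polyXnM odd_polyXnM => evJ /interlaced_mulXn /interlaced_prec.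
split => //; apply: (@mulfI _ ('X^h)); first by rewrite ?expf_neq0 ?polyX_eq0.
rewrite evJ -scalerAr -!mul_polyC; congr (_ * _).
by rewrite -addnn exprD mulrA.
Qed.

(** * Connected spanning subgraphs of a cycle of spindles *)

Lemma val_iter_ordS n (i : 'I_n) t : val (iter t (@ordS n) i) = ((i + t) %% n)%N.
Proof.
elim: t => [|t IH] /=; first by rewrite addn0 modn_small.
by rewrite IH -addn1 modnDml addn1 addnS.
Qed.

Lemma prod_nat_of_bool (K : comNzRingType) (I : finType) (P b : pred I) :
  \prod_(i | P i) (b i)%:R = ([forall (i | P i), b i])%:R :> K.
Proof.
have [/forall_inP h|] := boolP [forall (i | P i), b i].
  by rewrite big1 // => i /h ->.
move=> /forall_inPn[i Pi /negbTE bi].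
by rewrite (bigD1 i) //= bi mul0r.
Qed.

(** None or exactly one: each case is a product over the indices, so independence applies
    termwise. *)
Lemma card_le1_indicator (K : comNzRingType) (I : finType) (h : pred I) :
  (#|h| <= 1)%:R = \prod_i (~~ h i)%:R
     + \sum_i \prod_j (h j == (j == i))%:R :> K.
Proof.
rewrite prod_nat_of_bool (eq_bigr (fun i => ([forall j, h j == (j == i)])%:R)); last first.
  by move=> i _; rewrite prod_nat_of_bool.
have [h0|[k hk]] : (forall i, ~~ h i) \/ (exists k, h k).
  by have [/forallP|/forallPn[k]] := boolP [forall i, ~~ h i]; [left|rewrite negbK; right; exists k].
  have -> : (#|h| <= 1)%N by rewrite eq_card0 // => i; apply/negbTE/h0.
  have -> : [forall (i | xpredT i), ~~ h i] by apply/forallP.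
  rewrite big1 ?addr0 // => i _; case: forallP => // /(_ i).
  by rewrite eqxx (negbTE (h0 i)).
have -> : [forall (i | xpredT i), ~~ h i] = false.
  by apply/negbTE/forallPn; exists k; rewrite negbK.
rewrite add0r; have [h1|] := leqP #|h| 1.
  have hE j : h j = (j == k).
    by apply/idP/eqP => [hj|->//]; apply: (card_le1_eqP h1).
  rewrite (bigD1 k) //= big1 ?addr0 => [|i ik].
    by have -> : [forall j, h j == (j == k)] by apply/forallP => j; rewrite hE.
  case: forallP => // /(_ k); by rewrite hE eqxx [k == i]eq_sym (negbTE ik).
move=> h2; rewrite big1 // => i _.
have -> // : [forall j, h j == (j == i)] = false.
apply/negbTE; apply: contraTN h2 => /forallP hi.
by rewrite -leqNgt (eq_card (B := pred1 i)) ?card1 // => j; apply/eqP; apply: hi.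
Qed.

Section RandomSubset.
Variables (K : comNzRingType) (E I : finType) (f : E -> I) (p q : K).
Hypothesis pq1 : p + q = 1.

Definition subset_weight (S : {set E}) : K := p ^+ #|S| * q ^+ (#|E| - #|S|).

Definition missed (S : {set E}) (i : I) : bool := [forall (e | f e == i), e \notin S].

Lemma subset_weightE S : subset_weight S = \prod_e (if e \in S then p else q).
Proof.
rewrite /subset_weight (bigID (mem S)) /=; congr (_ * _).
  by rewrite -prodr_const; apply: eq_bigr => e ->.
rewrite -(cardsC S) addKn -prodr_const.
by apply: eq_big => [e|e]; rewrite !inE // => /negbTE ->.
Qed.

(** Edges over [Y] must be absent; each other edge contributes [p + q], which is 1. *)
Lemma sum_missed (Y : {set I}) :
  \sum_(S : {set E}) subset_weight S * \prod_(i in Y) (missed S i)%:R =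
  \prod_(i in Y) q ^+ #|[set e | f e == i]|.
Proof.
transitivity (\sum_(S : {set E})
    \prod_e (if e \in S then (if f e \in Y then 0 else p) else q)).
  apply: eq_bigr => S _; rewrite subset_weightE.
  have -> : \prod_(i in Y) (missed S i)%:R =
            \prod_(e | f e \in Y) ((e \notin S)%:R : K).
    rewrite (partition_big f (mem Y)) //=; apply: eq_bigr => i iY.
    rewrite -prod_nat_of_bool; apply: eq_bigl => e.
    by case: eqP => [->|]; rewrite ?andbF // iY.
  rewrite [X in _ * X]big_mkcond -big_split /=; apply: eq_bigr => e _.
  by case: (e \in S); case: (f e \in Y); rewrite ?mulr1 ?mulr0.
rewrite -(bigA_distr _ _ (fun e => if f e \in Y then 0 else p) (fun=> q)) /=.
transitivity (\prod_(e | f e \in Y) q).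
  by rewrite [RHS]big_mkcond; apply: eq_bigr => e _; case: ifP; rewrite ?add0r.
rewrite (partition_big f (mem Y)) //=; apply: eq_bigr => i iY.
rewrite -prodr_const; apply: eq_bigl => e; rewrite inE.
by case: eqP => [->|]; rewrite ?andbF // iY.
Qed.

(** Independence of the fibres of [f]: each factor is affine in the indicator of a missed fibre, so
    expanding the product reduces to [sum_missed]. *)
Lemma sum_prod_missed (a b : I -> K) :
  \sum_(S : {set E}) subset_weight S * \prod_i (if missed S i then a i else b i) =
  \prod_i (a i * q ^+ #|[set e | f e == i]| +
           b i * (1 - q ^+ #|[set e | f e == i]|)).
Proof.
pose g i := q ^+ #|[set e | f e == i]|.
pose w (Y : {set I}) := \prod_i (if i \in Y then a i - b i else b i).
have splitY (z : I -> K) (Y : {set I}) :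
    \prod_i (if i \in Y then (a i - b i) * z i else b i) = w Y * \prod_(i in Y) z i.
  rewrite [X in _ * X]big_mkcond -big_split /=; apply: eq_bigr => i _.
  by case: ifP; rewrite ?mulr1.
have expand (z : I -> K) : \prod_i ((a i - b i) * z i + b i) =
    \sum_(Y : {set I}) w Y * \prod_(i in Y) z i.
  by rewrite bigA_distr; apply: eq_bigr => Y _; rewrite splitY.
transitivity (\sum_(S : {set E}) \sum_(Y : {set I})
   w Y * (subset_weight S * \prod_(i in Y) (missed S i)%:R)).
  apply: eq_bigr => S _.
  rewrite (eq_bigr (fun i => (a i - b i) * (missed S i)%:R + b i)); last first.
    by move=> i _; case: ifP; rewrite ?mulr1 ?mulr0 ?subrK ?add0r.
  by rewrite expand mulr_sumr; apply: eq_bigr => Y _; rewrite mulrCA.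
rewrite exchange_big /=.
rewrite (eq_bigr (fun Y => w Y * \prod_(i in Y) g i)) => [|Y _]; last first.
  by rewrite -mulr_sumr sum_missed.
rewrite -expand; apply: eq_bigr => i _; rewrite /g; ring.
Qed.

Lemma sum_missed_le1 :
  \sum_(S : {set E} | (#|missed S| <= 1)%N) subset_weight S =
  \prod_i (1 - q ^+ #|[set e | f e == i]|) +
  \sum_i q ^+ #|[set e | f e == i]| * \prod_(j | j != i) (1 - q ^+ #|[set e | f e == j]|).
Proof.
rewrite big_mkcond /=.
transitivity (\sum_(S : {set E}) (subset_weight S * \prod_i (if missed S i then 0 else 1)
   + \sum_i subset_weight S * \prod_j (if missed S j then (j == i)%:R else (j != i)%:R))).
  apply: eq_bigr => S _; transitivity (subset_weight S * (#|missed S| <= 1)%:R).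
    by case: ifP; rewrite ?mulr1 ?mulr0.
  rewrite card_le1_indicator mulrDr mulr_sumr; congr (_ * _ + _).
    by apply: eq_bigr => i _; case: (missed S i).
  apply: eq_bigr => i _; congr (_ * _); apply: eq_bigr => j _.
  by case: (missed S j); case: (j == i).
rewrite big_split exchange_big /=; congr (_ + _).
  by rewrite sum_prod_missed; apply: eq_bigr => i _; rewrite mul0r add0r mul1r.
apply: eq_bigr => i _; rewrite sum_prod_missed (bigD1 i) //= eqxx mul1r mul0r addr0.
congr (_ * _); apply: eq_bigr => j /negbTE ji.
by rewrite ji mul0r add0r mul1r.
Qed.

End RandomSubset.

Section CycleConnectivity.
Variables (n : nat) (V E : finType) (ends : E -> V * V).
Variables (v : 'I_n -> V) (f : E -> 'I_n).
Hypothesis v_bij : bijective v.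
Hypothesis joinsE : forall e i, joins ends e (v i) (v (ordS i)) = (f e == i).

Lemma sub_adj_sym S : symmetric (sub_adj ends S).
Proof.
by move=> x y; apply: eq_existsb => e; rewrite /joins orbC.
Qed.

(** The vertices after [a] up to [b] form an arc which only the two missed spindles could leave. *)
Lemma missed_pair_disconnected S (a b : 'I_n) : (a < b)%N ->
  missed f S a -> missed f S b -> ~~ spanning_connected ends S.
Proof.
move=> ab /forall_inP ha /forall_inP hb; have [g vK gK] := v_bij.
apply/negP => /forallP/(_ (v a))/forallP/(_ (v b)) cab.
suff cl : closed (sub_adj ends S) [pred x | (a < g x <= b)%N].
  by have := closed_connect cl cab; rewrite !inE !vK ltnn ab leqnn.
have step e : e \in S -> (a < f e <= b)%N = (a < ordS (f e) <= b)%N.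
  move=> eS.
  have fa : f e != a by apply: contraL eS => /ha.
  have fb : f e != b by apply: contraL eS => /hb.
  rewrite /= -!val_eqE /= in fa fb *.
  have [lt|ge] := ltnP (f e).+1 n; first by rewrite modn_small //; lia.
  (* Wrap-around: the index n - 1 exceeds [b], so neither end of the edge lies in the arc. *)
  have -> : (f e).+1 = n by have := ltn_ord (f e); lia.
  by rewrite modnn; have := ltn_ord b; lia.
move=> x y /existsP[e /andP[eS exy]]; rewrite !inE.
have := joinsE e (f e); rewrite eqxx; move: exy; rewrite /joins.
move=> /orP[]/eqP-> /orP[]/eqP[] -> ->; rewrite !vK.
- exact: step.
- by rewrite step.
- by rewrite step.
- exact: step.
Qed.

(** Walking around the cycle from the vertex after [k] reaches every vertex without using spindle
    [k]. *)
Lemma missed_le1_connected S (k : 'I_n) :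
  (forall i, i != k -> ~~ missed f S i) -> spanning_connected ends S.
Proof.
move=> hk; have [g vK gK] := v_bij; have n0 : (0 < n)%N by case: (k) => m; lia.
have step t : (t < n)%N ->
    connect (sub_adj ends S) (v (ordS k)) (v (iter t.+1 (@ordS n) k)).
  elim: t => [|t IH] tn; first exact: connect0.
  apply: connect_trans (IH (ltnW tn)) _; apply: connect1.
  set i := iter t.+1 _ k.
  (* The index is k + t + 1 modulo n with 0 < t + 1 < n. *)
  have /hk/forall_inPn[e fe eS] : i != k.
    rewrite -val_eqE /i val_iter_ordS -[X in _ != X](modn_small (ltn_ord k)).
    by rewrite -[X in _ != X %[mod _]]addn0 eqn_modDl mod0n modn_small.
  rewrite negbK in eS; apply/existsP; exists e; rewrite eS /=.
  by rewrite joinsE.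
have all_conn x : connect (sub_adj ends S) (v (ordS k)) x.
  rewrite -(gK x); set j := g x.
  have -> : j = iter ((j + (n - k.+1)) %% n).+1 (@ordS n) k.
    apply: val_inj; rewrite val_iter_ordS addnS -addSn modnDmr addnCA subnKC //.
    by rewrite modnDr modn_small.
  by apply: step; rewrite ltn_mod.
apply/forallP => x; apply/forallP => y; apply: connect_trans (all_conn y).
by rewrite (sym_connect_sym (sub_adj_sym S)).
Qed.

Lemma spanning_connected_missed S : (0 < n)%N ->
  spanning_connected ends S = (#|missed f S| <= 1)%N.
Proof.
move=> n0; apply/idP/idP => [conn|h1].
  apply/card_le1_eqP => a b; rewrite !unfold_in => ha hb.
  apply: contraTeq conn => ab; rewrite -val_eqE neq_ltn in ab.
  by case/orP: ab => ab; apply: missed_pair_disconnected ab _ _.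
have [|/forallPn[k]] := boolP [forall i, ~~ missed f S i].
  by move=> /forallP h; apply: (@missed_le1_connected S (Ordinal n0)) => i _.
rewrite negbK => mk; apply: (@missed_le1_connected S k) => i.
by apply: contraNN => mi; apply/eqP; apply: (card_le1_eqP h1).
Qed.

End CycleConnectivity.

(** * The polynomial J of a cycle of spindles *)

Lemma dvdp_prod_1subXn (R : realType) (I : finType) (P : pred I) (c : I -> nat) :
  (1 - 'X : {poly R}) ^+ #|P| %| \prod_(i | P i) (1 - 'X^(c i)).
Proof.
rewrite (eq_bigr (fun i => (1 - 'X) * \sum_(k < c i) 'X^k)) => [|i _].
  by rewrite big_split /= prodr_const dvdp_mulr.
by rewrite -[LHS]opprB -[X in X * _]opprB subrX1 mulNr.
Qed.

Lemma size_sub1X (R : realType) k : size ((1 - 'X : {poly R}) ^+ k) = k.+1.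
Proof.
rewrite -opprB exprNn -polyC1 size_Msign.
by rewrite size_exp_XsubC.
Qed.

Lemma size_relpoly (R : realType) (V E : finType) (ends : E -> V * V) :
  (size (relpoly R ends) <= #|E|.+1)%N.
Proof.
apply: leq_trans (size_sum _ _ _) _; apply/bigmax_leqP => S _.
rewrite (leq_trans (size_polyMleq _ _)) // size_sub1X size_polyXn addSn /=.
by rewrite addnS ltnS subnKC // max_card.
Qed.

(** The substitution q = (u + 1) / (u - 1) breaks down only at u = 1. *)
Lemma poly_eq_off1 (R : realType) (p q : {poly R}) :
  (forall u, u != 1 -> p.[u] = q.[u]) -> p = q.
Proof.
move=> pq; apply/eqP; rewrite -subr_eq0; apply/eqP.
pose rs : seq R := [seq (i.+2)%:R | i <- iota 0 (size (p - q))].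
apply: (@roots_geq_poly_eq0 _ _ rs).
- apply/allP => _ /mapP[i _ ->]; apply/rootP.
  by rewrite hornerD hornerN pq ?subrr // pnatr_eq1.
- by rewrite map_inj_uniq ?iota_uniq // => i j /eqP; rewrite eqr_nat => /eqP[].
- by rewrite size_map size_iota.
Qed.

Lemma horner_half_diff (R : realType) c (u : R) : u != 1 ->
  (half_diff R c).[u] =
  (u - 1) ^+ c * (- 2^-1 * (1 - ((u + 1) / (u - 1)) ^+ c)).
Proof.
move=> u1; have a0 : (u - 1) ^+ c != 0 by rewrite expf_neq0 // subr_eq0.
rewrite /half_diff hornerZ hornerD hornerN !horner_exp !hornerD hornerX -polyC1.
by rewrite hornerN !hornerC expr_div_n; field.
Qed.

Lemma horner_half_sum (R : realType) c (u : R) : u != 1 ->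
  (half_sum R c).[u] =
  (u - 1) ^+ c * ((u + 1) / (u - 1)) ^+ c - (half_diff R c).[u].
Proof.
move=> u1; have a0 : (u - 1) ^+ c != 0 by rewrite expf_neq0 // subr_eq0.
rewrite /half_diff /half_sum !hornerZ !hornerD hornerN !horner_exp !hornerD hornerX -polyC1.
by rewrite hornerN !hornerC expr_div_n; field.
Qed.

Section Cycle.
Variables (R : realType) (n : nat) (V E : finType) (ends : E -> V * V).
Variable (c : 'I_n -> nat).
Hypothesis n2 : (2 <= n)%N.
Hypothesis cardV : #|V| = n.
Hypothesis cardE : #|E| = (\sum_(i < n) c i)%N.
Hypothesis c_gt0 : forall i, (0 < c i)%N.
Hypothesis rel : relpoly R ends = \prod_(i < n) (1 - 'X^(c i)) +
  \sum_(i < n) 'X^(c i) * \prod_(j < n | j != i) (1 - 'X^(c j)).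

Let leE : (n <= #|E|)%N.
Proof.
rewrite cardE -[X in (X <= _)%N]card_ord -sum1_card.
by apply: leq_sum => i _; apply: c_gt0.
Qed.

(** The division defining [Hpoly] is exact: each term of [rel] has at least n - 1 factors divisible
    by [1 - 'X]. *)
Lemma Hpoly_mul : Hpoly R ends * (1 - 'X) ^+ n.-1 = relpoly R ends.
Proof.
rewrite /Hpoly cardV divpK // rel; apply: dvdp_add.
  apply: dvdp_trans (dvdp_prod_1subXn _ _ _).
  by apply: dvdp_exp2l; rewrite card_ord leq_pred.
apply: (big_ind (fun p => (1 - 'X) ^+ n.-1 %| p)) => [|p q|i _]; [exact: dvdp0|exact: dvdp_add|apply: dvdp_mull].
apply: dvdp_trans (dvdp_prod_1subXn _ _ _).
by rewrite cardC1 card_ord.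
Qed.

Lemma Jpoly_cycle : Jpoly R ends =
  (n - 2)%:R *: \prod_(i < n) half_diff R (c i)
  + \sum_(i < n) half_sum R (c i) * \prod_(j < n | j != i) half_diff R (c j).
Proof.
apply: poly_eq_off1 => u u1.
set d := cyclo_rank V E.
have dE : (d + n.-1)%N = #|E| by rewrite /d /cyclo_rank cardV; lia.
pose a := u - 1; pose q := (u + 1) / a.
have a0 : a != 0 by rewrite subr_eq0.
(* Since 1 - q = -2 / a, dividing by a power of 1 - q multiplies by that power of -a / 2. *)
have qa : (1 - q) * (- 2^-1 * a) = 1 by rewrite /q /a; field.
(* With this bound the sum defining [Jpoly] misses no coefficient of [Hpoly]. *)
have sH : (size (Hpoly R ends) <= d.+1)%N.
  rewrite /Hpoly cardV size_divp ?size_sub1X /=; last first.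
    by rewrite -size_poly_gt0 size_sub1X.
  by rewrite leq_subLR addnS addnC dE size_relpoly.
have JE : (Jpoly R ends).[u] = a ^+ d * (Hpoly R ends).[q].
  rewrite /Jpoly -/d horner_sum (horner_coef_wide _ sH) mulr_sumr.
  apply: eq_bigr => k _; rewrite hornerZ hornerM !horner_exp.
  have -> : ('X - 1 : {poly R}).[u] = a by rewrite !hornerE.
  have -> : ('X + 1 : {poly R}).[u] = a * q by rewrite /q [a * _]mulrC divfK // !hornerE.
  have kd : (k <= d)%N by rewrite -ltnS.
  have -> : a ^+ d = a ^+ (d - k) * a ^+ k by rewrite -exprD subnK.
  rewrite exprMn; ring.
have HE : (Hpoly R ends).[q] = (- 2^-1 * a) ^+ n.-1 * (relpoly R ends).[q].
  rewrite -Hpoly_mul hornerM horner_exp.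
  have -> : (1 - 'X : {poly R}).[q] = 1 - q by rewrite !hornerE.
  by rewrite mulrCA -exprMn [_ * (1 - q)]mulrC qa expr1n mulr1.
rewrite JE HE exprMn; set b := - 2^-1.
rewrite hornerD hornerZ horner_prod [X in _ = _ + X]horner_sum.
pose T i := (half_diff R (c i)).[u].
pose Q i := q ^+ c i.
have TE i : T i = a ^+ c i * (b * (1 - Q i)) by rewrite /T horner_half_diff.
have relE : (relpoly R ends).[q] = \prod_(i < n) (1 - Q i) +
    \sum_(i < n) Q i * \prod_(j < n | j != i) (1 - Q j).
  rewrite rel hornerD horner_prod horner_sum; congr (_ + _).
    by apply: eq_bigr => i _; rewrite !hornerE.
  apply: eq_bigr => i _; rewrite hornerM horner_prod hornerXn; congr (_ * _).
  by apply: eq_bigr => j _; rewrite !hornerE.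
have am (P : pred 'I_n) : \prod_(i | P i) T i =
    (\prod_(i | P i) a ^+ c i) * (b ^+ #|P| * \prod_(i | P i) (1 - Q i)).
  by rewrite (eq_bigr _ (fun i _ => TE i)) !big_split /= prodr_const.
have aE : \prod_(i < n) a ^+ c i = a ^+ d * a ^+ n.-1.
  rewrite -exprD dE cardE.
  by rewrite (big_morph (fun k => a ^+ k) (id1 := 1) (op1 := *%R) (exprD _) (expr0 _)).
(* As U_i is a^(c_i) Q_i - T_i, each of the n summands subtracts one full product of the T_i. The
   term with all 1 - Q_i contributes b^(-1) = -2 such products, whence the factor n - 2. *)
have sumE : \sum_(i < n) (half_sum R (c i) * \prod_(j < n | j != i) half_diff R (c j)).[u]
  = a ^+ d * a ^+ n.-1 * b ^+ n.-1 * (\sum_(i < n) Q i * \prod_(j < n | j != i) (1 - Q j))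
    - n%:R * \prod_(i < n) T i.
  rewrite mulr_sumr -[n in n%:R]card_ord -sumr_const mulr_suml -sumrB.
  apply: eq_bigr => i _; rewrite hornerM horner_prod horner_half_sum // -/(T i) -/a -/q -/(Q i).
    rewrite -/(\prod_(j < n | j != i) T j) mulrBl [\prod_(i0 < n) T i0](bigD1 i) //= mul1r; congr (_ - _).
  rewrite am cardC1 card_ord -aE [\prod_(i0 < n) a ^+ _](bigD1 i) //=; ring.
rewrite sumE relE -/(\prod_(i < n) T i) am aE card_ord.
have -> : b ^+ n = b * b ^+ n.-1 by rewrite -exprS prednK // (leq_trans _ n2).
rewrite natrB // /b; by field.
Qed.

End Cycle.

(** * Assigning the edges of a cycle network to its spindles *)

Section CycleNetwork.
Variables (n : nat) (V E : finType) (ends : E -> V * V) (v : 'I_n -> V).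
Hypothesis n3 : (3 <= n)%N.
Hypothesis v_bij : bijective v.

Lemma ordS_ordS_neq (i : 'I_n) : ordS (ordS i) != i.
Proof.
rewrite -val_eqE -/(iter 2 (@ordS n) i) val_iter_ordS.
rewrite -[X in _ != X](modn_small (ltn_ord i)).
by rewrite -[X in _ != X %[mod _]]addn0 eqn_modDl mod0n modn_small.
Qed.

(** Matching the ends in reverse order would force i + 2 = i modulo n, impossible for n at least
    3. *)
Lemma joins_inj e i j : joins ends e (v i) (v (ordS i)) ->
  joins ends e (v j) (v (ordS j)) -> i = j.
Proof.
have vI := bij_inj v_bij; rewrite /joins => /orP[]/eqP-> /orP[]/eqP[].
- by move=> /vI.
- by move=> /vI -> /vI /eqP; rewrite (negbTE (ordS_ordS_neq j)).
- by move=> /vI <- /vI /esym /eqP; rewrite (negbTE (ordS_ordS_neq i)).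
- by move=> _ /vI.
Qed.

Lemma cycle_network_index :
  (forall e, exists i, joins ends e (v i) (v (ordS i))) ->
  exists f : E -> 'I_n, forall e i, joins ends e (v i) (v (ordS i)) = (f e == i).
Proof.
move=> h; exists (fun e => xchoose (h e)) => e i.
apply/idP/eqP => [|<-]; last exact: xchooseP (h e).
exact: joins_inj (xchooseP (h e)).
Qed.

End CycleNetwork.

Theorem theorem3p3 (R : realType) (n : nat) (c : 'I_n -> nat)
    (V E : finType) (ends : E -> V * V) :
  (3 <= n)%N ->
  (forall i, (0 < c i)%N) ->
  cycle_network c ends ->
  let m := (\sum_(i < n) c i)%N in
  (if odd (n + m) then J1 R ends else J0 R ends)
    = (n - 2)%:R *: ('X ^+ nu c * \prod_(i < n) Spoly R (c i)) /\
  prec (J1 R ends) (J0 R ends).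
Proof.
move=> n3 c0 [v [s [v_bij [cov cardc]]]] m.
have [f fE] := cycle_network_index n3 v_bij cov.
pose c' i := #|[set e | f e == i]|.
have cs i : c' i = c (s i).
  by rewrite -cardc; apply: eq_card => e; rewrite !inE fE.
(* The arrangement [s] enters only through symmetric sums and products. *)
have permE (T : Type) (idx : T) (op : Monoid.com_law idx) (F : nat -> T) :
    \big[op/idx]_(i < n) F (c i) = \big[op/idx]_(i < n) F (c' i).
  by rewrite (reindex_perm s); apply: eq_bigr => i _; rewrite cs.
have cardV : #|V| = n by rewrite -(bij_eq_card v_bij) card_ord.
have cardE : #|E| = (\sum_(i < n) c' i)%N.
  rewrite -sum1_card (partition_big f xpredT) //=; apply: eq_bigr => i _.
  by rewrite sum1dep_card.
have rel : relpoly R ends = \prod_(i < n) (1 - 'X^(c' i)) +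
  \sum_(i < n) 'X^(c' i) * \prod_(j < n | j != i) (1 - 'X^(c' j)).
  (* The weights are the polynomials [1 - 'X] and ['X], whose sum is 1 by [subrK]. *)
  rewrite -(sum_missed_le1 f (subrK _ _)); apply: eq_bigl => S.
  by rewrite (spanning_connected_missed v_bij fE) // (leq_trans _ n3).
have c'0 i : (0 < c' i)%N by rewrite cs.
have JE := Jpoly_cycle (ltnW n3) cardV cardE c'0 rel.
have := cycle_parts_prec n3 c'0 JE; rewrite /m /nu.
by rewrite (permE _ _ _ id) (permE _ _ _ eps) (permE _ _ _ (Spoly R)).
Qed.
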